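(* Let $F(\cdot,x,y,t):\mathbb{R}^n\rightrightarrows\mathbb{R}^n$ be a set-valued mapping, $\delta,\sigma,h>0$, $\theta=\delta/\sigma$, and let $$G(u_1,u_2,u,u_3,u_4,x,y,t)=-u_1-\theta^2u_2+\Big(2+2\theta^2-\frac{\delta^2}{h}\Big)u-\theta^2u_3+\frac{\delta^2}{h}u_4-\delta^2F(u,x,y,t).$$ Assume that $G$ is such that the cones of tangent directions $K_{G(\cdot,x,y,t)}(u_1,u_2,u,u_3,u_4,v)$, $(u_1,u_2,u,u_3,u_4,v)\in\mathrm{gph}\,G(\cdot,x,y,t)$, determine a local tent. Let $v^*\in\mathbb{R}^n$. Then the following are equivalent under the conditions that $u_1^*=-v^*$, $u_2^*=u_3^*=-\theta^2v^*$, $u_4^*=(\delta^2/h)v^*$: (1) $(u_1^*,u_2^*,u^*,u_3^*,u_4^* )\in G^*(v^*;(u_1,u_2,u,u_3,u_4,v),x,y,t)$, $\ v\in G_A(u_1,u_2,u,u_3,u_4;v^*,x,y,t)$; (2) $$\frac{u^*}{\delta^2}-\Big(\frac{2}{\delta^2}+\frac{2}{\sigma^2}-\frac1h\Big)v^*\in F^*\Big(-v^*;\Big(u,\Big(\frac{2}{\delta^2}+\frac{2}{\sigma^2}-\frac1h\Big)u+\frac1hu_4-\frac1{\delta^2}u_1-\frac1{\sigma^2}u_2-\frac1{\sigma^2}u_3-\frac1{\delta^2}v\Big),x,y,t\Big),$$ $$\Big(\frac{2}{\delta^2}+\frac{2}{\sigma^2}-\frac1h\Big)u+\frac1hu_4-\frac1{\delta^2}u_1-\frac1{\sigma^2}u_2-\frac1{\sigma^2}u_3-\frac1{\delta^2}v\in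 F_A(u;-v^*,x,y,t).$$
   Context: Here $x,y,t$ are fixed parameters and $u_1,u_2,u,u_3,u_4,v\in\mathbb{R}^n$. For a set-valued mapping $\Phi:\mathbb{R}^p\rightrightarrows\mathbb{R}^n$: $\mathrm{gph}\,\Phi=\{(z,v):v\in\Phi(z)\}$; Hamiltonian function $H_\Phi(z,v^* )=\sup\{\langle v,v^*\rangle:v\in\Phi(z)\}$; argmaximum set $\Phi_A(z;v^* )=\{v\in\Phi(z):\langle v,v^*\rangle=H_\Phi(z,v^* )\}$. The cone of tangent directions of a set $A$ at $z\in A$, denoted $K_A(z)$, is: for convex $A$, $K_A(z)=\{\mu(\tilde z-z):\mu>0,\tilde z\in A\}$; in general, the set of all $\bar z$ for which there is a function $\varphi$ with $z+\lambda\bar z+\varphi(\lambda)\in A$ for all sufficiently small $\lambda>0$ and $\lambda^{-1}\varphi(\lambda)\to0$ as $\lambda\downarrow0$. Write $K_\Phi(z,v)=K_{\mathrm{gph}\,\Phi}(z,v)$. The dual cone is $K^*=\{z^*:\langle\bar z,z^*\rangle\ge0\ \forall\bar z\in K\}$. $K_A(z)$ (a convex cone) is called a local tent if for each $\bar z_0\in\mathrm{ri}\,K_A(z)$ there exist a convex cone $K\subseteq K_A(z)$ and a continuous mapping $\psi(\bar z)$ defined in a neighborhood of the origin such that: (1) $\bar z_0\in\mathrm{ri}\,K$ and $\mathrm{Lin}\,K=\mathrm{Lin}\,K_A(z)$ ($\mathrm{Lin}$ is the linear span); (2) $\psi(\bar z)=\bar z+r(\bar z)$ with $\|\bar z\|^{-1}r(\bar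 z)\to0$ as $\bar z\to0$; (3) $z+\psi(\bar z)\in A$ for $\bar z\in K\cap S_\varepsilon(0)$ for some $\varepsilon>0$, where $S_\varepsilon(0)$ is the ball of radius $\varepsilon$ centered at the origin. The locally adjoint mapping (LAM) to $\Phi$ at $(z,v)\in\mathrm{gph}\,\Phi$ is $\Phi^*(v^*;(z,v))=\{z^*:(z^*,-v^* )\in K_\Phi^*(z,v)\}$. *)

(* Defs.v *)
From HB Require Import structures.
From mathcomp Require Import all_boot all_order all_algebra.
From mathcomp Require Import all_classical all_reals all_analysis.

Set Implicit Arguments.
Unset Strict Implicit.
Unset Printing Implicit Defensive.

Import Order.TTheory GRing.Theory Num.Theory.
Import numFieldNormedType.Exports.

Local Open Scope classical_set_scope.
Local Open Scope ring_scope.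

Definition inner (R : realType) (n : nat) (u v : 'rV[R]_n) : R :=
  (u *m v^T) 0 0.

(** The norm the library puts on row vectors is the max norm; its topology is
    the usual one, but lengths and balls are taken in the Euclidean norm. *)
Definition enorm (R : realType) (n : nat) (u : 'rV[R]_n) : R :=
  Num.sqrt (inner u u).

Definition gph (R : realType) (p n : nat) (Phi : 'rV[R]_p -> set 'rV[R]_n) :
    set 'rV[R]_(p + n) :=
  [set zv | exists z v, zv = row_mx z v /\ Phi z v].

(** Extended-real valued: possibly [+oo], and [-oo] where [Phi z] is empty. *)
Definition hamiltonian (R : realType) (p n : nat)
    (Phi : 'rV[R]_p -> set 'rV[R]_n) (z : 'rV[R]_p) (vs : 'rV[R]_n) : \bar R :=
  ereal_sup [set (inner v vs)%:E | v in Phi z].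

Definition argmaximum (R : realType) (p n : nat)
    (Phi : 'rV[R]_p -> set 'rV[R]_n) (z : 'rV[R]_p) (vs : 'rV[R]_n) :
    set 'rV[R]_n :=
  [set v | Phi z v /\ (inner v vs)%:E = hamiltonian Phi z vs].

Definition convex_tangent_cone (R : realType) (n : nat) (A : set 'rV[R]_n)
    (z : 'rV[R]_n) : set 'rV[R]_n :=
  [set zbar | exists (mu : R) (z' : 'rV[R]_n),
     [/\ 0 < mu, A z' & zbar = mu *: (z' - z)]].

Definition general_tangent_cone (R : realType) (n : nat) (A : set 'rV[R]_n)
    (z : 'rV[R]_n) : set 'rV[R]_n :=
  [set zbar | exists phi : R -> 'rV[R]_n,
     (\forall l \near 0^'+, A (z + l *: zbar + phi l)) /\
     l^-1 *: phi l @[l --> 0^'+] --> (0 : 'rV[R]_n)].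

(** For convex sets the first cone need not be closed, and the two may then
    differ; the convex case takes precedence. *)
Definition tangent_cone (R : realType) (n : nat) (A : set 'rV[R]_n)
    (z : 'rV[R]_n) : set 'rV[R]_n :=
  if `[< convex_set A >] then convex_tangent_cone A z
  else general_tangent_cone A z.

Definition dual_cone (R : realType) (n : nat) (K : set 'rV[R]_n) :
    set 'rV[R]_n :=
  [set zs | forall zbar, K zbar -> 0 <= inner zbar zs].

Definition lin_span (R : realType) (n : nat) (A : set 'rV[R]_n) :
    set 'rV[R]_n :=
  [set w | exists (k : nat) (c : 'I_k -> R) (a : 'I_k -> 'rV[R]_n),
     (forall i, A (a i)) /\ w = \sum_i c i *: a i].

Definition affine_hull (R : realType) (n : nat) (A : set 'rV[R]_n) :
    set 'rV[R]_n :=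
  [set w | exists (k : nat) (c : 'I_k -> R) (a : 'I_k -> 'rV[R]_n),
     [/\ forall i, A (a i), \sum_i c i = 1 & w = \sum_i c i *: a i]].

Definition ri (R : realType) (n : nat) (A : set 'rV[R]_n) : set 'rV[R]_n :=
  [set z | A z /\ \forall w \near z, affine_hull A w -> A w].

(** A cone is closed under multiplication by positive scalars; it is not
    required to contain the origin. *)
Definition convex_cone (R : realType) (n : nat) (K : set 'rV[R]_n) : Prop :=
  convex_set K /\ (forall (l : R) w, 0 < l -> K w -> K (l *: w)).

Definition local_tent (R : realType) (n : nat) (A : set 'rV[R]_n)
    (z : 'rV[R]_n) : Prop :=
  convex_cone (tangent_cone A z) /\
  forall zbar0, ri (tangent_cone A z) zbar0 ->
  exists (K : set 'rV[R]_n) (psi : 'rV[R]_n -> 'rV[R]_n),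
    [/\ convex_cone K /\ K `<=` tangent_cone A z,
        \forall w \near (0 : 'rV[R]_n), {for w, continuous psi},
        ri K zbar0 /\ lin_span K = lin_span (tangent_cone A z),
        exists r : 'rV[R]_n -> 'rV[R]_n,
          (\forall zbar \near (0 : 'rV[R]_n), psi zbar = zbar + r zbar) /\
          (enorm zbar)^-1 *: r zbar @[zbar --> (0 : 'rV[R]_n)^'] -->
            (0 : 'rV[R]_n)
      & exists2 eps : R, 0 < eps &
          forall zbar, K zbar -> enorm zbar < eps -> A (z + psi zbar)].

(** [Phi^*(vs; (z, v))] *)
Definition lam (R : realType) (p n : nat) (Phi : 'rV[R]_p -> set 'rV[R]_n)
    (vs : 'rV[R]_n) (z : 'rV[R]_p) (v : 'rV[R]_n) : set 'rV[R]_p :=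
  [set zs | dual_cone (tangent_cone (gph Phi) (row_mx z v)) (row_mx zs (- vs))].

Definition pack5 (R : realType) (n : nat) (u1 u2 u u3 u4 : 'rV[R]_n) :
    'rV[R]_(n + (n + (n + (n + n)))) :=
  row_mx u1 (row_mx u2 (row_mx u (row_mx u3 u4))).

Definition uncurry5 (R : realType) (n : nat) (T : Type)
    (g : 'rV[R]_n -> 'rV[R]_n -> 'rV[R]_n -> 'rV[R]_n -> 'rV[R]_n -> T)
    (z : 'rV[R]_(n + (n + (n + (n + n))))) : T :=
  g (lsubmx z) (lsubmx (rsubmx z)) (lsubmx (rsubmx (rsubmx z)))
    (lsubmx (rsubmx (rsubmx (rsubmx z))))
    (rsubmx (rsubmx (rsubmx (rsubmx z)))).

Lemma uncurry5_pack5 (R : realType) (n : nat) (T : Type)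
    (g : 'rV[R]_n -> 'rV[R]_n -> 'rV[R]_n -> 'rV[R]_n -> 'rV[R]_n -> T)
    (u1 u2 u u3 u4 : 'rV[R]_n) :
  uncurry5 g (pack5 u1 u2 u u3 u4) = g u1 u2 u u3 u4.
Proof. by rewrite /uncurry5 /pack5 !(row_mxKl, row_mxKr). Qed.

Definition Gmap (R : realType) (n : nat)
    (F : 'rV[R]_n -> R -> R -> R -> set 'rV[R]_n) (delta theta h : R)
    (u1 u2 u u3 u4 : 'rV[R]_n) (x y t : R) : set 'rV[R]_n :=
  [set - u1 - theta ^+ 2 *: u2 + (2 + 2 * theta ^+ 2 - delta ^+ 2 / h) *: u
       - theta ^+ 2 *: u3 + (delta ^+ 2 / h) *: u4 - delta ^+ 2 *: f
    | f in F u x y t].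

(* Main.v *)
Require Import Defs.
From HB Require Import structures.
From mathcomp Require Import all_boot all_order all_algebra.
From mathcomp Require Import ring.
From mathcomp Require Import all_classical all_reals all_analysis.

Set Implicit Arguments.
Unset Strict Implicit.
Unset Printing Implicit Defensive.

Import Order.TTheory GRing.Theory Num.Theory.
Import numFieldNormedType.Exports.

Local Open Scope classical_set_scope.
Local Open Scope ring_scope.

(** Solving the inclusion [v \in G(u1, u2, u, u3, u4)] for the value [w] of
    [F] taken at [u] gives a linear map
    [S : (u1, u2, u, u3, u4, v) |-> (u, w)], and it is onto because [w]
    involves [v] with the nonzero coefficient [- delta ^- 2].  So the graph of
    [G] is the preimage of the graph of [F] under a linear surjection, and
    everything in the theorem is transported along it.

    - Tangent cones commute with preimages under a linear surjection
      ([tangent_cone_preimage]): the correction term of a tangent curve is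
      pushed forward by [S] and pulled back by a linear right inverse of [S],
      both continuous, and for convex sets the segments themselves correspond.
      The same kind of cone is used on both sides since a set is convex if and
      only if its preimage is ([convex_set_preimage]).
    - Hence the dual cone at a point of the graph of [G] contains
      [S^T (zs, vs)] exactly when the dual cone at the image point contains
      [(zs, vs)] ([dual_cone_preimage]).  The given [u1s], [u2s], [u3s], [u4s]
      are those for which the functional
      [(u1s, u2s, us, u3s, u4s, - vs)] is [delta ^ 2] times an element of the
      range of [S^T], and a dual cone is stable under positive scaling.
    - Along a value of [G], the pairing with [vs] is a constant plus
      [delta ^ 2] times the pairing of the corresponding value of [F] with
      [- vs], so the two maximization problems have corresponding solutions
      ([argmaximum_Gmap]). *)

(** * Cones and preimages under a linear surjection *)

Lemma cvg_mulmxr0 (R : realType) (m n : nat) (M : 'M[R]_(m, n))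
    (T : Type) (D : set_system T) {FD : Filter D}
    (f : T -> 'rV[R]_m) :
  f x @[x --> D] --> (0 : 'rV[R]_m) ->
  f x *m M @[x --> D] --> (0 : 'rV[R]_n).
Proof.
move=> f0.
have -> : (fun x => f x *m M) = (fun x => \sum_i f x 0 i *: row i M).
  by apply/funext => x; rewrite mulmx_sum_row.
rewrite -[X in _ --> X](mul0mx _ M) mulmx_sum_row.
apply: cvg_big => [|i _]; first exact: add_continuous.
by apply: cvgZl; apply: (continuous_cvg _ (@coord_continuous _ _ _ 0 i 0)).
Qed.

Section LinearPreimage.
Variables (R : realType) (m n : nat) (M : 'M[R]_(m, n)).
Implicit Types (A K : set 'rV[R]_n).

Hypothesis Mfull : row_full M.

Let mul_pinv (w : 'rV[R]_n) : w *m pinvmx M *m M = w.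
Proof. by rewrite -mulmxA mulVpmx// mulmx1. Qed.

Lemma convex_set_preimage A :
  convex_set [set z : 'rV[R]_m | A (z *m M)] <-> convex_set A.
Proof.
have convM (z1 z2 : convex_lmodType 'rV[R]_m) (l : {i01 R}) :
    (conv l z1 z2 : 'rV[R]_m) *m M =
    conv l (z1 *m M : convex_lmodType 'rV[R]_n) (z2 *m M).
  by rewrite [LHS]mulmxDl -!scalemxAl.
split=> cA w1 w2 l; rewrite !inE => A1 A2.
  have := cA (w1 *m pinvmx M) (w2 *m pinvmx M) l.
  by rewrite !inE /= !mul_pinv => /(_ A1 A2); rewrite convM !mul_pinv.
have := cA (w1 *m M) (w2 *m M) l.
by rewrite !inE => /(_ A1 A2); rewrite /= convM.
Qed.

Lemma convex_tangent_cone_preimage A (z : 'rV[R]_m) :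
  convex_tangent_cone [set z | A (z *m M)] z =
  [set zbar | convex_tangent_cone A (z *m M) (zbar *m M)].
Proof.
apply/seteqP; split=> zbar /= [mu [w [mu0 Aw zbarE]]].
  exists mu, (w *m M); split=> //.
  by rewrite zbarE -scalemxAl mulmxBl.
(* The lift of [w] has to reproduce [zbar] itself and not only its image. *)
exists mu, (z + mu^-1 *: zbar); split=> //=.
  by rewrite mulmxDl -scalemxAl zbarE scalerA mulVf ?gt_eqF// scale1r subrKC.
by rewrite addrAC subrr add0r scalerA divff ?gt_eqF// scale1r.
Qed.

Lemma general_tangent_cone_preimage A (z : 'rV[R]_m) :
  general_tangent_cone [set z | A (z *m M)] z =
  [set zbar | general_tangent_cone A (z *m M) (zbar *m M)].
Proof.
apply/seteqP; split=> zbar /= [phi [Aphi phi0]].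
  exists (fun l => phi l *m M); split.
    by apply: filterS Aphi => l /=; rewrite !mulmxDl -scalemxAl.
  have := cvg_mulmxr0 M phi0.
  by under eq_fun do rewrite -scalemxAl; exact.
exists (fun l => phi l *m pinvmx M); split.
  by apply: filterS Aphi => l /=; rewrite !mulmxDl -scalemxAl mul_pinv.
have := cvg_mulmxr0 (pinvmx M) phi0.
by under eq_fun do rewrite -scalemxAl; exact.
Qed.

Lemma tangent_cone_preimage A (z : 'rV[R]_m) :
  tangent_cone [set z | A (z *m M)] z =
  [set zbar | tangent_cone A (z *m M) (zbar *m M)].
Proof.
rewrite /tangent_cone (asbool_equiv_eq (convex_set_preimage A)).
case: ifP => _; first exact: convex_tangent_cone_preimage.
exact: general_tangent_cone_preimage.
Qed.

(** Pairing with [M^T a] on the source is pairing with [a] after [M], and by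
    surjectivity every element of [K] is an image. *)
Lemma dual_cone_preimage K (a : 'rV[R]_n) :
  dual_cone [set z : 'rV[R]_m | K (z *m M)] (a *m M^T) <-> dual_cone K a.
Proof.
have innerM (z : 'rV[R]_m) : inner z (a *m M^T) = inner (z *m M) a.
  by rewrite /inner trmx_mul trmxK mulmxA.
split=> Ka w Kw; last by rewrite innerM; exact: Ka.
by rewrite -(mul_pinv w) -innerM; apply: Ka; rewrite /= mul_pinv.
Qed.

End LinearPreimage.

Lemma innerZr (R : realType) (n : nat) (k : R) (u v : 'rV[R]_n) :
  inner u (k *: v) = k * inner u v.
Proof. by rewrite /inner linearZ /= -scalemxAr mxE. Qed.

Lemma dual_cone_scale (R : realType) (n : nat) (K : set 'rV[R]_n)
    (k : R) (a : 'rV[R]_n) : 0 < k ->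
  dual_cone K (k *: a) <-> dual_cone K a.
Proof.
by move=> k0; split=> Ka w /Ka; rewrite innerZr pmulr_rge0.
Qed.

(** * Graphs and maximizers *)

Lemma gph_row_mx (R : realType) (p n : nat) (Phi : 'rV[R]_p -> set 'rV[R]_n)
    (z : 'rV[R]_p) (v : 'rV[R]_n) :
  gph Phi (row_mx z v) <-> Phi z v.
Proof.
split=> [[z' [v' [/eq_row_mx[-> ->]]]]//|Phizv].
by exists z, v.
Qed.

Lemma argmaximumP (R : realType) (p n : nat)
    (Phi : 'rV[R]_p -> set 'rV[R]_n) (z : 'rV[R]_p) (vs v : 'rV[R]_n) :
  argmaximum Phi z vs v <->
  Phi z v /\ forall v', Phi z v' -> inner v' vs <= inner v vs.
Proof.
split=> -[Phiv vmax]; split=> //.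
  move=> v' Phiv'; rewrite -lee_fin vmax.
  by apply: ereal_sup_ubound; exists v'.
apply/eqP; rewrite eq_le; apply/andP; split.
  by apply: ereal_sup_ubound; exists v.
by apply: ge_ereal_sup => _ [v' Phiv' <-]; rewrite lee_fin; exact: vmax.
Qed.

(** * The linear substitution *)

(** For [a = delta ^- 2], [b = sigma ^- 2], [d = h^-1] this is the matrix of
    the substitution [S], written to act on row vectors from the right: one
    block row for each of [u1, u2, u, u3, u4, v], one block column for each of
    [u] and [w]. *)
Definition stencil_mx (R : realType) (n : nat) (a b c d : R) :
    'M[R]_(n + (n + (n + (n + n))) + n, n + n) :=
  col_mx (col_mx (row_mx 0 (- a)%:M) (col_mx (row_mx 0 (- b)%:M)
         (col_mx (row_mx 1%:M c%:M) (col_mx (row_mx 0 (- b)%:M)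
                 (row_mx 0 d%:M)))))
         (row_mx 0 (- a)%:M).

Section Stencil.
Variables (R : realType) (n : nat) (a b c d : R).
Local Notation S := (stencil_mx n a b c d).

Lemma mul_stencil (u1 u2 u u3 u4 v : 'rV[R]_n) :
  row_mx (pack5 u1 u2 u u3 u4) v *m S =
  row_mx u (c *: u + d *: u4 - a *: u1 - b *: u2 - b *: u3 - a *: v).
Proof.
rewrite /stencil_mx /pack5 !mul_row_col !mul_mx_row !mulmx0 !mulmx1.
rewrite !mul_mx_scalar !add_row_mx !add0r !addr0 !scaleNr; congr row_mx.
by apply/rowP => i; rewrite !mxE; ring.
Qed.

Lemma mul_stencil_tr (p q : 'rV[R]_n) :
  row_mx p q *m S^T =
  row_mx (pack5 (- a *: q) (- b *: q) (p + c *: q) (- b *: q) (d *: q))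
         (- a *: q).
Proof.
rewrite /stencil_mx /pack5 !tr_col_mx !tr_row_mx !trmx0 !tr_scalar_mx.
by rewrite !mul_mx_row !mul_row_col !mulmx0 !mulmx1 !mul_mx_scalar !add0r.
Qed.

Lemma row_full_stencil : a != 0 -> row_full S.
Proof.
move=> a0; rewrite -sub1mx; apply/row_subP => i.
move: (row i _) => w.
(* Given the first output [u], the entry [v] alone reaches any second one. *)
have -> : w = row_mx (pack5 0 0 (lsubmx w) 0 0)
                (a^-1 *: (c *: lsubmx w - rsubmx w)) *m S.
  rewrite mul_stencil -[LHS]hsubmxK; congr row_mx.
  by rewrite !scaler0 !subr0 addr0 scalerA divff// scale1r subKr.
exact: submxMl.
Qed.

End Stencil.

(** * Correspondence between the two mappings *)

Section Correspondence.
Variables (R : realType) (n : nat) (F : 'rV[R]_n -> R -> R -> R -> set 'rV[R]_n).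
Variables (delta sigma h theta x y t : R).
Hypotheses (delta_gt0 : 0 < delta) (sigma_gt0 : 0 < sigma) (h_gt0 : 0 < h).
Hypothesis thetaE : theta = delta / sigma.

Let c := 2 / delta ^+ 2 + 2 / sigma ^+ 2 - h^-1.
Let w (u1 u2 u u3 u4 v : 'rV[R]_n) :=
  c *: u + h^-1 *: u4 - (delta ^+ 2)^-1 *: u1
  - (sigma ^+ 2)^-1 *: u2 - (sigma ^+ 2)^-1 *: u3 - (delta ^+ 2)^-1 *: v.
Let G := uncurry5 (fun u1 u2 u u3 u4 =>
           Gmap F delta theta h u1 u2 u u3 u4 x y t).
Local Notation S :=
  (stencil_mx n (delta ^+ 2)^-1 (sigma ^+ 2)^-1 c h^-1).

Lemma Gmap_mem (u1 u2 u u3 u4 v : 'rV[R]_n) :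
  Gmap F delta theta h u1 u2 u u3 u4 x y t v <->
  F u x y t (w u1 u2 u u3 u4 v).
Proof.
have d0 : delta != 0 by rewrite gt_eqF.
have s0 : sigma != 0 by rewrite gt_eqF.
have h0 : h != 0 by rewrite gt_eqF.
split=> [[f Ff <-]|Fw].
  rewrite (_ : w _ _ _ _ _ _ = f)//.
  by apply/rowP => i; rewrite /w /c thetaE !mxE; field; rewrite d0 s0 h0.
exists (w u1 u2 u u3 u4 v) => //.
by apply/rowP => i; rewrite /w /c thetaE !mxE; field; rewrite d0 s0 h0.
Qed.

Lemma gph_Gmap :
  gph G = [set z | gph (fun u => F u x y t) (z *m S)].
Proof.
apply/funext => z; apply/propext.
rewrite -(hsubmxK z); move: (lsubmx z) (rsubmx z) => {}z v.
rewrite -(hsubmxK z) -(hsubmxK (rsubmx z)) -(hsubmxK (rsubmx (rsubmx z))).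
rewrite -(hsubmxK (rsubmx (rsubmx (rsubmx z)))) -/(pack5 _ _ _ _ _).
by rewrite gph_row_mx /= mul_stencil gph_row_mx /G uncurry5_pack5 Gmap_mem.
Qed.

Lemma argmaximum_Gmap (u1 u2 u u3 u4 v vs : 'rV[R]_n) :
  argmaximum G (pack5 u1 u2 u u3 u4) vs v <->
  argmaximum (fun u => F u x y t) u (- vs) (w u1 u2 u u3 u4 v).
Proof.
have d0 : 0 < delta ^+ 2 by rewrite exprn_gt0.
rewrite !argmaximumP /G uncurry5_pack5 Gmap_mem.
(* [w] contains [v] only in the term [- delta ^- 2 v]; the two signs cancel
   in the pairing of [w] with [- vs], so the order of pairings is kept. *)
have cmp v1 v2 :
    (inner v1 vs <= inner v2 vs) =
    (inner (w u1 u2 u u3 u4 v1) (- vs) <= inner (w u1 u2 u u3 u4 v2) (- vs)).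
  rewrite /w /inner linearN /= !mulmxN !mulmxBl -!scalemxAl !mxE.
  by rewrite lerN2 lerD2l lerN2 ler_pM2l ?invr_gt0.
split=> -[Fw wmax]; split=> //.
  move=> f Ff.
  pose v' := delta ^+ 2 *: (w u1 u2 u u3 u4 0 - f).
  have wv' : w u1 u2 u u3 u4 v' = f.
    rewrite /v' /w scalerA mulVf ?gt_eqF// scale1r scaler0 subr0.
    by rewrite subKr.
  by rewrite -wv' -cmp; apply: wmax; rewrite Gmap_mem wv'.
by move=> v' /Gmap_mem Fw'; rewrite cmp; exact: wmax.
Qed.

(** The factor [delta ^ 2] by which the functional on the source differs from
    [S^T] of the functional on the target is absorbed by scaling. *)
Lemma lam_Gmap (u1 u2 u u3 u4 v us vs : 'rV[R]_n) :
  lam G vs (pack5 u1 u2 u u3 u4) v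
    (pack5 (- vs) (- (theta ^+ 2 *: vs)) us (- (theta ^+ 2 *: vs))
           ((delta ^+ 2 / h) *: vs)) <->
  lam (fun u => F u x y t) (- vs) u (w u1 u2 u u3 u4 v)
    ((delta ^+ 2)^-1 *: us - c *: vs).
Proof.
have d0 : 0 < delta ^+ 2 by rewrite exprn_gt0.
have d2 : delta ^+ 2 != 0 by rewrite gt_eqF.
have Sfull : row_full S by rewrite row_full_stencil// invr_eq0.
rewrite /lam /= opprK gph_Gmap tangent_cone_preimage// mul_stencil.
set p := (_ *: us - _).
have -> : row_mx (pack5 (- vs) (- (theta ^+ 2 *: vs)) us (- (theta ^+ 2 *: vs))
                        ((delta ^+ 2 / h) *: vs)) (- vs) =
          delta ^+ 2 *: row_mx p vs *m S^T.
  have dvs : delta ^+ 2 *: (- (delta ^+ 2)^-1 *: vs) = - vs.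
    by rewrite scalerA mulrN divff// scaleN1r.
  have tvs : delta ^+ 2 *: (- (sigma ^+ 2)^-1 *: vs) = - (theta ^+ 2 *: vs).
    by rewrite scalerA mulrN -expr_div_n -thetaE scaleNr.
  rewrite -scalemxAl mul_stencil_tr /pack5 !scale_row_mx dvs tvs scalerA.
  by rewrite /p subrK scalerA divff// scale1r.
by rewrite dual_cone_preimage// dual_cone_scale.
Qed.

End Correspondence.

Theorem theorem4p2 (R : realType) (n : nat)
    (F : 'rV[R]_n -> R -> R -> R -> set 'rV[R]_n)
    (delta sigma h theta : R) (x y t : R)
    (delta_gt0 : 0 < delta) (sigma_gt0 : 0 < sigma) (h_gt0 : 0 < h)
    (thetaE : theta = delta / sigma) :
  let F_xyt := fun u => F u x y t in
  let G_xyt := uncurry5 (fun u1 u2 u u3 u4 =>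
                 Gmap F delta theta h u1 u2 u u3 u4 x y t) in
  (forall u1 u2 u u3 u4 v : 'rV[R]_n,
     gph G_xyt (row_mx (pack5 u1 u2 u u3 u4) v) ->
     local_tent (gph G_xyt) (row_mx (pack5 u1 u2 u u3 u4) v)) ->
  forall u1 u2 u u3 u4 v vs u1s u2s us u3s u4s : 'rV[R]_n,
  u1s = - vs ->
  u2s = - (theta ^+ 2 *: vs) ->
  u3s = - (theta ^+ 2 *: vs) ->
  u4s = (delta ^+ 2 / h) *: vs ->
  let c := 2 / delta ^+ 2 + 2 / sigma ^+ 2 - h^-1 in
  let w := c *: u + h^-1 *: u4 - (delta ^+ 2)^-1 *: u1
           - (sigma ^+ 2)^-1 *: u2 - (sigma ^+ 2)^-1 *: u3
           - (delta ^+ 2)^-1 *: v in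
  (lam G_xyt vs (pack5 u1 u2 u u3 u4) v (pack5 u1s u2s us u3s u4s) /\
   argmaximum G_xyt (pack5 u1 u2 u u3 u4) vs v)
  <->
  (lam F_xyt (- vs) u w ((delta ^+ 2)^-1 *: us - c *: vs) /\
   argmaximum F_xyt u (- vs) w).
Proof.
move=> F_xyt G_xyt _ u1 u2 u u3 u4 v vs u1s u2s us u3s u4s -> -> -> -> c w.
have lamE := lam_Gmap F x y t delta_gt0 sigma_gt0 h_gt0 thetaE.
have argE := argmaximum_Gmap F x y t delta_gt0 sigma_gt0 h_gt0 thetaE.
by split=> -[/lamE ? /argE ?].
Qed.
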